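(* The function $h\mapsto c_h h$, with $c_h\geq 0$, is the upper bound of the cost function $(x,h)\mapsto \mathsf{cost}^{[k]}(x,h)$ (i.e. $\mathsf{cost}^{[k]}(x,h)\leq c_hh$ for all $x\geq\mathbf{0}$) which is attained at $x=\mathbf{0}$ (i.e. the point with $x=\mathbf{0}$, $z=c_hh$ and homogenization variable $h$ belongs to the cone $\mathcal{C}(\overline{A}^{[k]})$) if and only if the following two conditions hold: $$\mathbb{x}^{+}=\emptyset\qquad\text{and}\qquad \overline{A}^{[k]}_{[|0,m|]\,h}\leq\mathbf{0}.$$
   Context: The state of the problem after $k$ substitutions is as follows. The remaining variables form a set $\mathbb{x}\subseteq\{x_1,\dots,x_n\}$, and $x=(x_1,\dots,x_n)$ is the vector of remaining variables, with the convention that $x_j=0$ in $x$ if $x_j\notin\mathbb{x}$. There is a homogenization variable $h$, with $(x,h)\in\overline{\mathbb{R}}^{\,n}\times\overline{\mathbb{R}}$, where $\overline{\mathbb{R}}=\mathbb{R}\cup\{-\infty,+\infty\}$, and $h$ is assumed to satisfy $h\neq 0$. The current cost function is $\mathsf{cost}^{[k]}(x,h)=c^{\intercal}x+c_hh$ with current real coefficients $c_j$ and $c_h$, and $z$ is the variable bounded above by the cost. The polyhedral cone is $$\mathcal{C}(\overline{A}^{[k]})=\{w=(z,x,h)^{\intercal}\in\overline{\mathbb{R}}^{\,n+2}:\ \overline{A}^{[k]}w\leq\mathbf{0}\},\qquad \overline{A}^{[k]}=\begin{pmatrix}1&-c^{\intercal}&-c_h\\0&-c^{\intercal}&-c_h\\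 \mathbf{0}&A&-b\end{pmatrix},$$ with $A\in\mathbb{R}^{m\times n}$, $b\in\mathbb{R}^m$ denoting the current data. The rows of $\overline{A}^{[k]}$ are numbered from $-1$ to $m$, and its columns are labelled $z,x_1,\dots,x_n,h$ in this order. $\overline{A}^{[k]}_{[|0,m|]\,h}$ is the column labelled $h$ restricted to rows $0,1,\dots,m$. $\mathbb{x}^{+}=\{x_j\in\mathbb{x}: c_j>0\}$. Inequalities between vectors are componentwise.
   Formalization: Attainment at x = 0 (membership of the point in the cone) is required for all positive h, including +∞, rather than for every h ≠ 0; for negative h the claim fails, e.g. n = 0, m = 1, b = 1, c_h = 1, h = −1. *)

(* Defs.v *)
From HB Require Import structures.
From mathcomp Require Import all_boot all_order all_algebra.
From mathcomp Require Import classical_sets reals ereal.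

Set Implicit Arguments.
Unset Strict Implicit.
Unset Printing Implicit Defensive.

Import Order.TTheory GRing.Theory Num.Theory.
Local Open Scope ring_scope.
Local Open Scope classical_set_scope.

(* Product of a real matrix and an extended real column vector.  MathComp's
   conventions apply: [0 * +oo = 0 * -oo = 0] and [+oo + -oo = -oo].
   With the latter, [u - v <= 0] is equivalent to [u <= v] (lemma [sube_le0]),
   so a row [z - v <= 0] means [z <= v] even at infinite values. *)
Definition emulmx (R : realType) (p q : nat)
    (M : 'M[R]_(p, q)) (w : 'cV[\bar R]_q) : 'cV[\bar R]_p :=
  \col_i (\sum_(j < q) (M i j)%:E * w j ord0)%E.

Definition cone (R : realType) (p q : nat) (M : 'M[R]_(p, q)) :
    set 'cV[\bar R]_q :=
  [set w | forall i, (emulmx M w i ord0 <= 0)%E].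

(* Rows are usually numbered from -1 to m; row k has index [k + 1] here. The
   columns are [z], [x_1], ..., [x_n], [h]. *)
Definition Abar (R : realType) (m n : nat) (A : 'M[R]_(m, n)) (b : 'cV[R]_m)
    (c : 'cV[R]_n) (ch : R) : 'M[R]_(1 + (1 + m), 1 + (n + 1)) :=
  col_mx (row_mx (const_mx 1) (row_mx (- c^T) (const_mx (- ch))))
 (col_mx (row_mx (const_mx 0) (row_mx (- c^T) (const_mx (- ch))))
         (row_mx (const_mx 0) (row_mx A (- b)))).

(* The column labelled [h], without its row [-1]. *)
Definition hcol (R : realType) (m n : nat)
    (M : 'M[R]_(1 + (1 + m), 1 + (n + 1))) : 'cV[R]_(1 + m) :=
  dsubmx (rsubmx (rsubmx M)).

Definition zxh (R : realType) (n : nat) (z : \bar R) (x : 'cV[\bar R]_n)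
    (h : \bar R) : 'cV[\bar R]_(1 + (n + 1)) :=
  col_mx (const_mx z) (col_mx x (const_mx h)).

Definition cost (R : realType) (n : nat) (c : 'cV[R]_n) (ch : R)
    (x : 'cV[\bar R]_n) (h : \bar R) : \bar R :=
  (\sum_(j < n) (c j ord0)%:E * x j ord0 + ch%:E * h)%E.

(* [X] is the set of indices of the remaining variables. *)
Definition remaining_vector (R : realType) (n : nat) (X : {set 'I_n})
    (x : 'cV[\bar R]_n) : Prop :=
  forall j, j \notin X -> x j ord0 = 0%E.

Definition posvars (R : realType) (n : nat) (X : {set 'I_n}) (c : 'cV[R]_n) :
    {set 'I_n} :=
  [set j in X | 0 < c j ord0]%SET.

Definition cost_bounded (R : realType) (n : nat) (X : {set 'I_n})
    (c : 'cV[R]_n) (ch : R) : Prop :=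
  forall (x : 'cV[\bar R]_n) (h : \bar R),
    remaining_vector X x -> (forall j, (0 <= x j ord0)%E) -> h != 0%E ->
    (cost c ch x h <= ch%:E * h)%E.

(* Of the nonzero values of [h], only the positive ones are considered here:
   for [h < 0] the rows [0, ..., m] of the cone's inequalities would force
   [ch <= 0] and [b <= 0] instead of [0 <= ch] and [0 <= b]. *)
Definition bound_attained_at0 (R : realType) (m n : nat) (A : 'M[R]_(m, n))
    (b : 'cV[R]_m) (c : 'cV[R]_n) (ch : R) : Prop :=
  forall h : \bar R, h != 0%E -> (0 <= h)%E ->
    cone (Abar A b c ch) (zxh (ch%:E * h)%E (const_mx 0%E) h).

(* Main.v *)
Require Import Defs.
From HB Require Import structures.
From mathcomp Require Import all_boot all_order all_algebra.
From mathcomp Require Import reals ereal.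

(** Both sides come down to signs.  At [x = 0] the rows of the cone's system
    collapse to [z <= ch * h], [- ch * h <= 0] and [- b i * h <= 0]
    ([cone_Abar_at0]); with [z = ch * h] the first one always holds, and for
    positive [h] the others say that the entries [- ch] and [- b i] of the
    column [h] ([hcol_Abar]) are nonpositive.  It suffices to test [h = 1] in
    one direction, and in the other a product of a nonpositive real and a
    nonnegative extended real is nonpositive, also when [h = +oo].

    As to the bound, [cost c ch x h <= ch * h] compares the linear part
    [\sum_j c j * x j] with [0].  If no remaining variable has a positive
    coefficient, every term is nonpositive.  If [x_j] has one, the [j]-th unit
    vector with [h = 1] has cost [c j + ch], which exceeds [ch]
    ([cost_boundedP]).  The value of [h] is kept finite there, since an
    infinite [ch * h] would hide the contribution of [x]. *)

Set Implicit Arguments.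
Unset Strict Implicit.
Unset Printing Implicit Defensive.

Import Order.TTheory GRing.Theory Num.Theory.
Local Open Scope ring_scope.

Lemma emulmx_row_mx (R : realType) (p q1 q2 : nat) (M : 'M[R]_(p, q1))
    (N : 'M[R]_(p, q2)) (v : 'cV[\bar R]_q1) (w : 'cV[\bar R]_q2) i :
  emulmx (row_mx M N) (col_mx v w) i ord0 =
  (emulmx M v i ord0 + emulmx N w i ord0)%E.
Proof.
rewrite !mxE big_split_ord /=; congr (_ + _)%E; apply: eq_bigr => j _.
  by rewrite row_mxEl col_mxEu.
by rewrite row_mxEr col_mxEd.
Qed.

Lemma emulmx_col_mx (R : realType) (p1 p2 q : nat) (M : 'M[R]_(p1, q))
    (N : 'M[R]_(p2, q)) (w : 'cV[\bar R]_q) :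
  emulmx (col_mx M N) w = col_mx (emulmx M w) (emulmx N w).
Proof.
apply/colP => i; rewrite -(splitK i); case: (split i) => k /=;
  rewrite ?(col_mxEu, col_mxEd) !mxE; apply: eq_bigr => j _;
  by rewrite ?(col_mxEu, col_mxEd).
Qed.

Lemma emulmx_const (R : realType) (p : nat) (M : 'cV[R]_p) (z : \bar R) i :
  emulmx M (const_mx z) i ord0 = ((M i ord0)%:E * z)%E.
Proof. by rewrite mxE big_ord1 mxE. Qed.

Lemma emulmx0 (R : realType) (p q : nat) (M : 'M[R]_(p, q)) i :
  emulmx M (const_mx 0%E) i ord0 = 0%E.
Proof. by rewrite mxE big1 // => j _; rewrite mxE mule0. Qed.

Lemma emulmx_zxh_at0 (R : realType) (p n : nat) (a d : 'cV[R]_p)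
    (B : 'M[R]_(p, n)) (z h : \bar R) i :
  emulmx (row_mx a (row_mx B d)) (zxh z (const_mx 0%E) h) i ord0 =
  ((a i ord0)%:E * z + (d i ord0)%:E * h)%E.
Proof. by rewrite !emulmx_row_mx !emulmx_const emulmx0 add0e. Qed.

Lemma forall_col_mx (T : Type) (p q : nat) (P : T -> Prop) (u : 'cV[T]_p)
    (v : 'cV[T]_q) :
  (forall i, P (col_mx u v i ord0)) <->
  (forall i, P (u i ord0)) /\ (forall i, P (v i ord0)).
Proof.
split=> [H|[Hu Hv] i].
  by split=> i; [rewrite -(col_mxEu u v) | rewrite -(col_mxEd u v)].
by rewrite -(splitK i); case: (split i) => k /=; rewrite ?(col_mxEu, col_mxEd).
Qed.

Lemma hcol_Abar (R : realType) (m n : nat) (A : 'M[R]_(m, n)) (b : 'cV[R]_m)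
    (c : 'cV[R]_n) (ch : R) :
  hcol (Abar A b c ch) = col_mx (const_mx (- ch)) (- b).
Proof.
apply/colP => i; rewrite 3!mxE col_mxEd.
rewrite -(splitK i); case: (split i) => k /=.
  by rewrite !col_mxEu !row_mxEr.
by rewrite !col_mxEd !row_mxEr.
Qed.

(** The rows numbered [0] to [m] have no [z]-entry, so at [x = 0] they only see
    the column [h]; row [-1] is the one that bounds [z]. *)
Lemma cone_Abar_at0 (R : realType) (m n : nat) (A : 'M[R]_(m, n))
    (b : 'cV[R]_m) (c : 'cV[R]_n) (ch : R) (z h : \bar R) :
  cone (Abar A b c ch) (zxh z (const_mx 0%E) h) <->
  (z <= ch%:E * h)%E /\
  (forall i, ((hcol (Abar A b c ch) i ord0)%:E * h <= 0)%E).
Proof.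
rewrite hcol_Abar.
rewrite (forall_col_mx (fun r : R => (r%:E * h <= 0)%E : Prop)).
rewrite /cone /= /Abar !emulmx_col_mx.
rewrite (forall_col_mx (fun y : \bar R => (y <= 0)%E : Prop)).
rewrite (forall_col_mx (fun y : \bar R => (y <= 0)%E : Prop)).
have row_z i : emulmx (row_mx (const_mx 1) (row_mx (- c^T) (const_mx (- ch))))
    (zxh z (const_mx 0%E) h) i ord0 = (z - ch%:E * h)%E.
  by rewrite emulmx_zxh_at0 !mxE mul1e EFinN mulNe.
have row_h p (B : 'M[R]_(p, n)) (d : 'cV[R]_p) i :
    emulmx (row_mx (const_mx 0) (row_mx B d)) (zxh z (const_mx 0%E) h) i ord0 =
    ((d i ord0)%:E * h)%E.
  by rewrite emulmx_zxh_at0 mxE mul0e add0e.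
(* Moving [ch * h] across the inequality is sound even if [z] and [ch * h] are
   the same infinity, because then their difference is [-oo]. *)
split=> [[Hz [H0 Hb]]|[Hz [H0 Hb]]]; split; try split.
- by have := Hz ord0; rewrite row_z sube_le0.
- by move=> i; rewrite -(row_h _ (- c^T)).
- by move=> i; rewrite -(row_h _ A).
- by move=> i; rewrite row_z sube_le0.
- by move=> i; rewrite row_h.
- by move=> i; rewrite row_h.
Qed.

Lemma cost_boundedP (R : realType) (n : nat) (X : {set 'I_n}) (c : 'cV[R]_n)
    (ch : R) :
  cost_bounded X c ch <-> posvars X c = set0.
Proof.
split=> [bnd|noX x h x0X x_ge0 _].
  apply/setP => j; rewrite !inE; apply/negP => /andP[jX cj_gt0].
  pose e : 'cV[\bar R]_n := \col_k ((k == j)%:R)%:E.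
  have eX : remaining_vector X e.
    by move=> k kX; rewrite mxE; case: eqP kX => [->|//]; rewrite jX.
  have e_ge0 k : (0 <= e k ord0)%E by rewrite mxE lee_fin ler0n.
  have := bnd e 1%E eX e_ge0 onee_neq0.
  rewrite /cost (bigD1 j) //= big1 => [|k kj]; last first.
    by rewrite mxE (negPf kj) mule0.
  rewrite mxE eqxx adde0 !mule1 -EFinD lee_fin gerDr.
  by rewrite leNgt cj_gt0.
rewrite /cost -[leRHS]add0e; apply: leeD2r; apply: sume_le0 => j _.
have [jX|jX] := boolP (j \in X); last by rewrite x0X // mule0.
apply: mule_le0_ge0 => //; rewrite lee_fin leNgt.
by have /setP/(_ j) := noX; rewrite !inE jX /= => ->.
Qed.

Lemma bound_attained_at0P (R : realType) (m n : nat) (A : 'M[R]_(m, n))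
    (b : 'cV[R]_m) (c : 'cV[R]_n) (ch : R) :
  bound_attained_at0 A b c ch <->
  (forall i, hcol (Abar A b c ch) i ord0 <= 0).
Proof.
split=> [att i|hle0 h _ h_ge0].
  have /cone_Abar_at0[_ /(_ i)] := att 1%E onee_neq0 lee01.
  by rewrite mule1 lee_fin.
apply/cone_Abar_at0; split=> // i.
by apply: mule_le0_ge0 => //; rewrite lee_fin.
Qed.

Theorem theorem6p1 (R : realType) (m n : nat) (X : {set 'I_n})
    (A : 'M[R]_(m, n)) (b : 'cV[R]_m) (c : 'cV[R]_n) (ch : R) :
  [/\ 0 <= ch, cost_bounded X c ch & bound_attained_at0 A b c ch] <->
  posvars X c = set0 /\ (forall i, hcol (Abar A b c ch) i ord0 <= 0).
Proof.
split=> [[_ /cost_boundedP noX /bound_attained_at0P hle0] //|[noX hle0]].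
split; [|exact/cost_boundedP|exact/bound_attained_at0P].
(* The entry of the column [h] in row [0] is [- ch]. *)
have := hle0 (lshift m ord0).
by rewrite hcol_Abar col_mxEu mxE oppr_le0.
Qed.
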